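(* For all integers $n\ge 0$, \begin{align*} M^{*}(0,2,n)&>M^{*}(1,2,n)\quad\text{if } n\equiv 0\pmod 2,\\ M^{*}(0,2,n)&<M^{*}(1,2,n)\quad\text{if } n\equiv 1\pmod 2. \end{align*}
   Context: Notation: $(a;q)_\infty:=\prod_{j=0}^{\infty}(1-aq^{j})$ and $(a_1,\dots,a_r;q)_\infty:=(a_1;q)_\infty\cdots(a_r;q)_\infty$. For integers $m$ and $n\ge 0$, the integer $M^{*}(m,n)$ is the (weighted) number of $2$-colored partitions of $n$ with Garvan bicrank equal to $m$; it is determined by the generating function $$\sum_{m=-\infty}^{\infty}\sum_{n=0}^{\infty}M^{*}(m,n)z^{m}q^{n}=\frac{(q;q)_{\infty}^{2}}{(zq,z^{-1}q,z^{2}q,z^{-2}q;q)_{\infty}},$$ where the right side is expanded as a formal power series in $q$ whose coefficients are Laurent polynomials in $z$ (this identity may be taken as the definition of $M^*(m,n)$). For integers $j$, $k\ge 1$, $n\ge 0$, set $$M^{*}(j,k,n):=\sum_{m\equiv j \,(\mathrm{mod}\ k)}M^{*}(m,n),$$ which is a finite sum. *)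

(* Defs.v *)
From HB Require Import structures.
From mathcomp Require Import all_boot all_order all_algebra.
From mathcomp Require Import finmap.
From mathcomp.multinomials Require Import monalg.

Set Implicit Arguments.
Unset Strict Implicit.
Unset Printing Implicit Defensive.

Import Order.TTheory GRing.Theory Num.Theory.
Local Open Scope fset_scope.
Local Open Scope ring_scope.

(** Laurent polynomials in z over the integers, i.e. finitely supported
    functions from exponents to coefficients; [f@_m] is the coefficient of z^m.
    The ring structure provided by monalg requires a monoid of exponents without
    nontrivial units, which excludes the group [int], so only the additive
    structure is inherited and the convolution product is defined here. *)
Definition laurent := {malg int[int]}.

HB.instance Definition _ := GRing.Zmodule.on laurent.

Definition zpow (e : int) : laurent := << e >>.

Definition laurent_mul (f g : laurent) : laurent :=
  \sum_(a <- msupp f) \sum_(b <- msupp g) << f@_a * g@_b *g a + b >>.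

Section LaurentRing.
Implicit Types f g h : laurent.

Let mulw (d1 d2 : {fset int}) f g :
  msupp f `<=` d1 -> msupp g `<=` d2 ->
  laurent_mul f g = \sum_(a <- d1) \sum_(b <- d2) << f@_a * g@_b *g a + b >>.
Proof.
move=> le1 le2; rewrite /laurent_mul (big_fset_incl _ le1) /=.
  apply/eq_bigr=> a _; apply/big_fset_incl => // b _ /mcoeff_outdom ->.
  by rewrite mulr0 monalgU0.
move=> a _ /mcoeff_outdom fa.
by rewrite big1 // => b _; rewrite fa mul0r monalgU0.
Qed.

Let mulC : commutative laurent_mul.
Proof.
move=> f g; rewrite /laurent_mul exchange_big; apply/eq_bigr=> a _.
by apply/eq_bigr=> b _; rewrite mulrC addrC.
Qed.

Let mulDl : left_distributive laurent_mul +%R.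
Proof.
move=> f g h.
rewrite (mulw (msuppD_le f g) (fsubset_refl (msupp h))).
rewrite (mulw (fsubsetUl (msupp f) (msupp g)) (fsubset_refl (msupp h))).
rewrite (mulw (fsubsetUr (msupp f) (msupp g)) (fsubset_refl (msupp h))).
rewrite -big_split /=; apply/eq_bigr=> a _.
rewrite -big_split /=; apply/eq_bigr=> b _.
by rewrite mcoeffD mulrDl monalgUD.
Qed.

Let mul0 : left_zero 0 laurent_mul.
Proof. by move=> f; rewrite /laurent_mul msupp0 big_seq_fset0. Qed.

Let mulDr : right_distributive laurent_mul +%R.
Proof. by move=> f g h; rewrite mulC mulDl !(mulC f). Qed.

Let mulr0 : right_zero 0 laurent_mul.
Proof. by move=> f; rewrite mulC mul0. Qed.

Let mulUU c1 c2 a b :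
  laurent_mul << c1 *g a >> << c2 *g b >> = << c1 * c2 *g a + b >>.
Proof. by rewrite (mulw msuppU_le msuppU_le) !big_seq_fset1 !mcoeffUU. Qed.

Let mulUg c a g :
  laurent_mul << c *g a >> g = \sum_(b <- msupp g) << c * g@_b *g a + b >>.
Proof.
rewrite (mulw msuppU_le (fsubset_refl _)) big_seq_fset1.
by apply/eq_bigr=> b _; rewrite mcoeffUU.
Qed.

Let mulEl f g :
  laurent_mul f g = \sum_(a <- msupp f) laurent_mul << f@_a *g a >> g.
Proof. by apply/eq_bigr=> a _; rewrite mulUg. Qed.

Let mulEr f g :
  laurent_mul f g = \sum_(b <- msupp g) laurent_mul f << g@_b *g b >>.
Proof. by rewrite mulC mulEl; apply/eq_bigr=> b _; rewrite mulC. Qed.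

Let mulA : associative laurent_mul.
Proof.
move=> f g h.
rewrite [RHS](big_morph (laurent_mul^~ h) (fun _ _ => mulDl _ _ _) (mul0 _)).
rewrite mulEl; apply/eq_bigr=> a _.
rewrite [LHS](big_morph (laurent_mul _) (fun _ _ => mulDr _ _ _) (mulr0 _)).
rewrite [RHS](big_morph (laurent_mul^~ h) (fun _ _ => mulDl _ _ _) (mul0 _)).
apply/eq_bigr=> b _.
rewrite [LHS](big_morph (laurent_mul _) (fun _ _ => mulDr _ _ _) (mulr0 _)).
by rewrite mulEr; apply/eq_bigr=> c _; rewrite !mulUU mulrA addrA.
Qed.

Let mul1 : left_id (zpow 0) laurent_mul.
Proof.
move=> f; rewrite mulUg [RHS]monalgE.
by apply/eq_bigr=> b _; rewrite mul1r add0r.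
Qed.

Let one_neq0 : zpow 0 != 0 :> laurent.
Proof. by rewrite monalgU_eq0 oner_eq0. Qed.

HB.instance Definition _ := GRing.Zmodule_isComNzRing.Build laurent
  mulA mulC mul1 mulDl one_neq0.

Lemma zpow0 : zpow 0 = 1.
Proof. by []. Qed.

Lemma zpowD a b : zpow (a + b) = zpow a * zpow b.
Proof. by rewrite [RHS]mulUU mulr1. Qed.

End LaurentRing.

(** Formal power series in q, given by their coefficient sequences;
    polynomials in q are [{poly R}], with ['X] standing for q. *)
Section Series.
Variable R : comNzRingType.

Definition series := nat -> R.

Definition series1 : series := fun n => (n == 0%N)%:R.

Definition series_mul (f g : series) : series :=
  fun n => \sum_(i < n.+1) f i * g (n - i)%N.

(** The inverse of a series f with constant term 1: the coefficient of q^n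
    in 1/f = sum_k (1 - f)^k only involves the terms k <= n and the truncation
    of f modulo q^(n+1). *)
Definition series_inv (f : series) : series :=
  fun n => (\sum_(k < n.+1) (1 - \poly_(i < n.+1) f i) ^+ k)`_n.

(** (a; q)_infinity: the factors with j > n are 1 modulo q^(n+1), so the
    coefficient of q^n is that of the product over j <= n
    (see [coef_qpoch_stable]). *)
Definition qpoch (a : {poly R}) : series :=
  fun n => (\prod_(j < n.+1) (1 - a * 'X^j))`_n.

(** (a_1, ..., a_r; q)_infinity *)
Definition qpochs (s : seq {poly R}) : series :=
  \big[series_mul/series1]_(a <- s) qpoch a.

Lemma coef_qpoch_stable (a : {poly R}) n N : (n < N)%N ->
  (\prod_(j < N) (1 - a * 'X^j))`_n = qpoch a n.
Proof.
elim: N => // N IHN; rewrite ltnS leq_eqVlt => /predU1P[-> // | ltnN].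
rewrite big_ord_recr /= mulrBr mulr1 coefB IHN // mulrA coefMXn ltnN.
by rewrite subr0.
Qed.

Lemma series_mulV (f : series) : f 0%N = 1 ->
  series_mul f (series_inv f) =1 series1.
Proof.
move=> f0 n; rewrite /series_mul.
pose p N := \poly_(i < N.+1) f i.
have truncP (u v : {poly R}) N :
    (forall i, (i <= N)%N -> u`_i = v`_i) ->
    forall k i, (i <= N)%N -> (u ^+ k)`_i = (v ^+ k)`_i.
  move=> uv; elim=> [|k IHk] i leiN; first by rewrite !expr0.
  rewrite !exprS !coefM; apply: eq_bigr => j _.
  have lejN : (j <= N)%N by apply: leq_trans leiN; rewrite -ltnS.
  by rewrite uv // IHk // (leq_trans (leq_subr _ _)).
have low N k i : (i < k)%N -> ((1 - p N) ^+ k)`_i = 0.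
  have [r ->] : exists r, 1 - p N = r * 'X.
    exists (\poly_(i < N) (1 - p N)`_i.+1); apply/polyP => -[|j].
      by rewrite coefMX /= coefB coef1 /p coef_poly /= f0 subrr.
    rewrite coefMX /= coef_poly; case: ltnP => // leNj.
    by rewrite coefB coef1 /p coef_poly ltnS ltnNge leNj subr0.
  by move=> ltik; rewrite exprMn_comm ?coefMXn ?ltik //; apply: mulrC.
have invE i : (i <= n)%N ->
    series_inv f i = (\sum_(k < n.+1) (1 - p n) ^+ k)`_i.
  move=> lein; rewrite /series_inv !coef_sum.
  have -> : \sum_(k < n.+1) ((1 - p n) ^+ k)`_i =
            \sum_(k < i.+1) ((1 - p n) ^+ k)`_i.
    rewrite -!(big_mkord xpredT (fun k => ((1 - p n) ^+ k)`_i)).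
    rewrite (big_cat_nat (n := i.+1)) //= -[RHS]addr0; congr (_ + _).
    by rewrite big_nat_cond big1 // => k /andP[/andP[ltik _] _]; apply: low.
  apply: eq_bigr => k _; apply: (truncP _ _ i) => // j leji.
  by rewrite !coefB /p !coef_poly !ltnS leji (leq_trans leji).
transitivity ((p n * \sum_(k < n.+1) (1 - p n) ^+ k)`_n).
  rewrite coefM; apply: eq_bigr => i _.
  by rewrite coef_poly ltn_ord invE // leq_subr.
have -> : p n * \sum_(k < n.+1) (1 - p n) ^+ k = 1 - (1 - p n) ^+ n.+1.
  have := subrXX 1 (1 - p n) n.+1; rewrite expr1n subKr => ->.
  by congr (_ * _); apply: eq_bigr => k _; rewrite expr1n mul1r.
by rewrite coefB low // subr0 coef1.
Qed.

Lemma qpochs_const (s : seq {poly R}) :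
  all (fun a : {poly R} => a`_0 == 0) s -> qpochs s 0%N = 1.
Proof.
rewrite /qpochs; elim: s => [|a s IHs]; first by rewrite big_nil.
case/andP=> /eqP a0 /IHs; rewrite big_cons /series_mul big_ord1 => ->.
by rewrite mulr1 /qpoch big_ord1 expr0 mulr1 coefB coef1 a0 subr0.
Qed.

End Series.

(** The generating function of M^*,
    (q; q)^2 / (z q, z^-1 q, z^2 q, z^-2 q; q)_infinity. *)
Definition bicrank_den : series laurent :=
  qpochs [:: zpow 1 *: 'X; zpow (-1) *: 'X; zpow 2 *: 'X; zpow (-2) *: 'X].

Lemma bicrank_denV :
  series_mul bicrank_den (series_inv bicrank_den) =1 @series1 laurent.
Proof.
by apply/series_mulV/qpochs_const; rewrite /= !coefZ coefX !mulr0 eqxx.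
Qed.

Definition bicrank_gf : series laurent :=
  series_mul (series_mul (qpoch 'X) (qpoch 'X)) (series_inv bicrank_den).

Definition Mstar (m : int) (n : nat) : int := (bicrank_gf n)@_m.

(** The sum over all m congruent to j modulo k, restricted to the finitely many
    m with a nonzero term. *)
Definition Mstar_mod (j : int) (k n : nat) : int :=
  \sum_(m <- msupp (bicrank_gf n) | (m == j %[mod k%:Z])%Z) Mstar m n.

(* Main.v *)
From HB Require Import structures.
Require Import Defs.
From mathcomp Require Import all_boot all_order all_algebra.
From mathcomp Require Import ring.
From mathcomp.multinomials Require Import monalg.

Set Implicit Arguments.
Unset Strict Implicit.
Unset Printing Implicit Defensive.

Import Order.TTheory GRing.Theory Num.Theory.
Local Open Scope ring_scope.

(** Since (-1)^m separates even from odd m, the number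
    M^*(0,2,n) - M^*(1,2,n) is the coefficient of q^n in the generating
    function at z = -1.  There the factors with z^2 and z^-2 in the denominator
    cancel the numerator, and what remains is 1 / (-q; q)_oo^2.  By Euler's
    identity (q; q^2)_oo (-q; q)_oo = 1, this is (q; q^2)_oo^2, which is
    lemma [bicrank_gf_at_neg1].

    Changing q into -q turns (q; q^2)_oo into the generating function
    prod_j (1 + q^(2j+1)) of the partitions into distinct odd parts, so
    (-1)^n times the coefficient of q^n in (q; q^2)_oo^2 counts the pairs of
    such partitions with total size n.  There is always such a pair: two empty
    partitions if n = 0, the parts n and nothing if n is odd, and the parts
    n - 1 and 1 if n > 0 is even.  This is lemma [oddprod_sqr_gt0]; it gives
    the sign of the difference.

    Infinite products and inverses are handled through polynomials that have
    the right coefficients up to q^n, the relation [approx] below. *)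

(** * Polynomial approximations of power series *)

Definition approx {R : comNzRingType} (n : nat) (p : {poly R}) (f : nat -> R) :=
  forall i, (i <= n)%N -> p`_i = f i.

(** This is congruence modulo 'X^(n+1). *)
Definition eqmodX {R : comNzRingType} (n : nat) (p q : {poly R}) :=
  approx n p (fun i => q`_i).

Section Approx.
Variable R : comNzRingType.
Implicit Types (p q : {poly R}) (f g : series R).

Lemma approxM n p q f g :
  approx n p f -> approx n q g -> approx n (p * q) (series_mul f g).
Proof.
move=> pf qg i lein; rewrite coefM; apply: eq_bigr => j _.
have leji : (j <= i)%N by rewrite -ltnS.
by rewrite pf ?qg // (leq_trans _ lein) // leq_subr.
Qed.

Lemma eqmodXM n p p' q q' :
  eqmodX n p p' -> eqmodX n q q' ->
  eqmodX n (p * q) (p' * q').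
Proof. by move=> pp qq i lein; rewrite (approxM pp qq) // coefM. Qed.

Lemma approx1 n : approx n 1 (series1 R).
Proof. by move=> i _; rewrite coef1. Qed.

Lemma eqmodX_prod1 n (I : Type) (r : seq I) (P : pred I) (F : I -> {poly R}) :
  (forall i, P i -> eqmodX n (F i) 1) ->
  eqmodX n (\prod_(i <- r | P i) F i) 1.
Proof.
move=> F1; apply: (big_ind (fun p => eqmodX n p 1)) => // p q p1 q1.
by rewrite -[1]mulr1; apply: eqmodXM.
Qed.

Lemma approx_qpoch n (a : {poly R}) :
  approx n (\prod_(j < n.+1) (1 - a * 'X^j)) (qpoch a).
Proof. by move=> i lein; rewrite coef_qpoch_stable. Qed.

Lemma approx_qpochs n (s : seq {poly R}) :
  approx n (\prod_(a <- s) \prod_(j < n.+1) (1 - a * 'X^j)) (qpochs s).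
Proof.
rewrite /qpochs; elim: s => [|a s IHs].
  by rewrite !big_nil; apply: approx1.
by rewrite !big_cons; apply: approxM => //; apply: approx_qpoch.
Qed.

End Approx.

(** * Euler's identity *)

Definition oddprod (R : comNzRingType) (k : nat) : {poly R} :=
  \prod_(i < k) (1 - 'X^(i.*2.+1)).

Section Euler.
Variable R : idomainType.

(** The finite form of Euler's identity: the factors of prod_(i <= 2k) (1 - q^i)
    with even exponent are those of prod_(i <= k) (1 - q^i) (1 + q^i), and
    the common factor prod_(i <= k) (1 - q^i) can be cancelled. *)
Lemma oddprod_prod1DX k :
  oddprod R k * \prod_(i < k) (1 + 'X^(i.+1)) =
  \prod_(i < k) (1 - 'X^((k + i).+1)).
Proof.
pose A : {poly R} := \prod_(i < k) (1 - 'X^(i.+1)).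
have A_neq0 : A != 0.
  apply/prodf_neq0 => i _; apply/eqP => /polyP/(_ 0%N)/eqP.
  by rewrite coefB coef1 coefXn coef0 subr0 oner_eq0.
apply: (mulfI A_neq0).
rewrite -(big_split_ord _ xpredT (fun i : 'I_(k + k) => 1 - 'X^(i.+1))) /=.
rewrite addnn {A_neq0}/A /oddprod; elim: k => [|k IHk].
  by rewrite !big_ord0 !mulr1.
rewrite doubleS !big_ord_recr /= -IHk.
have -> : 'X^(k.*2.+2) = 'X^(k.+1) * 'X^(k.+1) :> {poly R}.
  by rewrite -exprD addnn doubleS.
ring.
Qed.

Lemma euler_eqmodX n k : (n <= k)%N ->
  eqmodX n (oddprod R k * \prod_(i < k) (1 + 'X^(i.+1))) 1.
Proof.
move=> lenk; rewrite oddprod_prod1DX; apply: eqmodX_prod1 => i _ j lejn.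
rewrite coefB coefXn ltn_eqF ?subr0 // ltnS.
by rewrite (leq_trans lejn) // (leq_trans lenk) // leq_addr.
Qed.

End Euler.

(** * Signs of the coefficients of products of odd factors *)

(** The polynomials that get nonnegative coefficients when 'X is replaced
    by - 'X. *)
Definition alternating (R : numDomainType) (p : {poly R}) :=
  forall i, 0 <= (-1) ^+ i * p`_i.

Section Alternating.
Variable R : numDomainType.
Implicit Types p q : {poly R}.

Lemma signed_coefM p q n :
  (-1) ^+ n * (p * q)`_n =
  \sum_(i < n.+1) ((-1) ^+ i * p`_i) * ((-1) ^+ (n - i) * q`_(n - i)).
Proof.
rewrite coefM mulr_sumr; apply: eq_bigr => i _.
have {1}-> : n = (i + (n - i))%N by rewrite subnKC // -ltnS.
by rewrite exprD; ring.
Qed.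

Lemma alternatingM p q : alternating p -> alternating q -> alternating (p * q).
Proof.
move=> pP qP n; rewrite signed_coefM sumr_ge0 // => i _.
exact: mulr_ge0.
Qed.

Lemma alternatingM_gt0 p q i j : alternating p -> alternating q ->
  0 < (-1) ^+ i * p`_i -> 0 < (-1) ^+ j * q`_j ->
  0 < (-1) ^+ (i + j) * (p * q)`_(i + j).
Proof.
move=> pP qP pi qj; rewrite signed_coefM.
have lti : (i < (i + j).+1)%N by rewrite ltnS leq_addr.
rewrite (bigD1 (Ordinal lti)) //= addKn ltr_wpDr //; last exact: mulr_gt0.
by apply: sumr_ge0 => l _; apply: mulr_ge0.
Qed.

Lemma alternating_1BX m : odd m -> alternating (1 - 'X^m : {poly R}).
Proof.
move=> om i; rewrite coefB coef1 coefXn.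
case: (eqVneq i m) => [->|_].
  by rewrite -signr_odd om; case: m om => // m _; rewrite sub0r mulrNN mulr1.
rewrite subr0; case: i => [|i]; first by rewrite expr0 mul1r ler01.
by rewrite /= mulr0n mulr0.
Qed.

Lemma alternating_prod_odd (I : Type) (r : seq I) (P : pred I) (m : I -> nat) :
  (forall i, odd (m i)) ->
  alternating (\prod_(i <- r | P i) (1 - 'X^(m i) : {poly R})).
Proof.
move=> om; apply: big_ind => [|p q|i _]; last exact: alternating_1BX.
- by move=> [|i]; rewrite coef1 ?mulr0 ?mulr1.
- exact: alternatingM.
Qed.

Lemma oddprod_alternating k : alternating (oddprod R k).
Proof. by apply: alternating_prod_odd => i; rewrite /= odd_double. Qed.

Lemma coef0_prod_odd (I : Type) (r : seq I) (P : pred I) (m : I -> nat) :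
  (forall i, odd (m i)) ->
  (\prod_(i <- r | P i) (1 - 'X^(m i) : {poly R}))`_0 = 1.
Proof.
move=> om; apply: (big_ind (fun p : {poly R} => p`_0 = 1)).
- by rewrite coef1.
- by move=> p q p0 q0; rewrite coef0M p0 q0 mulr1.
- move=> i _; rewrite coefB coef1 coefXn.
  by case: (m i) (om i) => //= l; rewrite subr0.
Qed.

(** This term comes from the empty partition. *)
Lemma oddprod_coef0_gt0 k : 0 < (-1) ^+ 0 * (oddprod R k)`_0.
Proof.
by rewrite coef0_prod_odd ?mulr1 // => i; rewrite /= odd_double.
Qed.

(** The single part m is a partition into distinct odd parts: it arises from the
    term 'X^m of the factor 1 - 'X^m and the constant terms of the others. *)
Lemma oddprod_coef_gt0 k m : odd m -> (m < k.*2)%N ->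
  0 < (-1) ^+ m * (oddprod R k)`_m.
Proof.
move=> om ltmk.
have mE : m = m./2.*2.+1 by rewrite -[LHS]odd_double_half om.
have ltm2k : (m./2 < k)%N by rewrite -ltn_double (leq_trans _ ltmk) // -mE.
rewrite /oddprod (bigD1 (Ordinal ltm2k)) //= -mE.
have odd2 (i : 'I_k) : odd i.*2.+1 by rewrite /= odd_double.
rewrite -[X in (-1) ^+ X]addn0 -[X in _`_X]addn0.
apply: alternatingM_gt0.
- exact: alternating_1BX.
- exact: alternating_prod_odd.
- rewrite coefB coef1 coefXn eqxx -signr_odd om.
  by rewrite mE sub0r mulrNN mulr1.
- by rewrite coef0_prod_odd ?mulr1.
Qed.

(** A partition of n into at most two odd parts, put in different components of
    the pair, gives a positive term of the product. *)
Lemma oddprod_sqr_gt0 n k : (n < k.*2)%N ->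
  0 < (-1) ^+ n * (oddprod R k * oddprod R k)`_n.
Proof.
move=> ltnk; have alt := oddprod_alternating k.
have [on|] := boolP (odd n).
  rewrite -[n]addn0; apply: alternatingM_gt0 => //.
    exact: oddprod_coef_gt0.
  exact: oddprod_coef0_gt0.
case: n ltnk => [|n] ltnk en.
  by rewrite -[0%N]addn0; apply: alternatingM_gt0 => //; apply: oddprod_coef0_gt0.
rewrite -addn1; apply: alternatingM_gt0 => //; apply: oddprod_coef_gt0 => //.
- by rewrite /= negbK in en.
- exact: ltnW.
- by rewrite (leq_ltn_trans _ ltnk).
Qed.

End Alternating.

(** * Evaluation of Laurent polynomials at z = -1 *)

Definition at_neg1 (f : laurent) : int := mmap idfun (fun m : int => (-1) ^ m) f.

Lemma at_neg1_is_zmod_morphism : zmod_morphism at_neg1.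
Proof. exact: mmap_is_additive. Qed.

HB.instance Definition _ :=
  GRing.isZmodMorphism.Build laurent int at_neg1 at_neg1_is_zmod_morphism.

Lemma at_neg1U (c m : int) : at_neg1 << c *g m >> = c * (-1) ^ m.
Proof. exact: mmapU. Qed.

Lemma at_neg1_zpow m : at_neg1 (zpow m) = (-1) ^ m.
Proof. by rewrite at_neg1U mul1r. Qed.

Lemma at_neg1_is_monoid_morphism : monoid_morphism at_neg1.
Proof.
split=> [|f g]; first exact: at_neg1_zpow.
rewrite [f * g]/(laurent_mul f g) /laurent_mul raddf_sum.
rewrite [at_neg1 f]mmapE mulr_suml.
apply: eq_bigr => a _; rewrite raddf_sum [at_neg1 g]mmapE mulr_sumr.
apply: eq_bigr => b _; rewrite /= at_neg1U exprzDr ?unitrN1 //.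
by rewrite mulrACA.
Qed.

HB.instance Definition _ :=
  GRing.isMonoidMorphism.Build laurent int at_neg1 at_neg1_is_monoid_morphism.

Lemma modz2E (m : int) :
  ((m == 0 %[mod 2])%Z = ~~ odd `|m|%N) * ((m == 1 %[mod 2])%Z = odd `|m|%N).
Proof.
case: m => m; first by rewrite !modz_nat !modn2 absz_nat; case: (odd m).
by rewrite (modNz_nat m (d := 2)) // modn2 /=; case: (odd m).
Qed.

Lemma Mstar_mod2B n :
  Mstar_mod 0 2 n - Mstar_mod 1 2 n = at_neg1 (bicrank_gf n).
Proof.
rewrite /Mstar_mod /at_neg1 mmapE /Mstar.
rewrite [RHS](bigID (fun m : int => (m == 0 %[mod 2])%Z)) -sumrN /=.
congr (_ + _); last rewrite (eq_bigl (fun m : int => ~~ (m == 0 %[mod 2])%Z)).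
- apply: eq_bigr => m; rewrite modz2E expN1r -signr_odd => /negPf->.
  by rewrite mulr1.
- apply: eq_bigr => m; rewrite modz2E negbK expN1r -signr_odd => ->.
  by rewrite mulrN1.
- by move=> m; rewrite !modz2E negbK.
Qed.

(** * The generating function at z = -1 *)

(** The first factor comes from the exponents 1 and -1, where z^m becomes -1,
    the second one from the exponents 2 and -2, where it becomes 1. *)
Lemma bicrank_den_at_neg1 k :
  map_poly at_neg1
    (\prod_(a <- [:: zpow 1 *: 'X; zpow (-1) *: 'X;
                     zpow 2 *: 'X; zpow (-2) *: 'X])
       \prod_(j < k) (1 - a * 'X^j)) =
  (\prod_(j < k) (1 + 'X^(j.+1))) ^+ 2 * (\prod_(j < k) (1 - 'X^(j.+1))) ^+ 2.
Proof.
have E (c : int) : map_poly at_neg1 (\prod_(j < k) (1 - zpow c *: 'X * 'X^j)) =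
    \prod_(j < k) (1 - (-1) ^+ odd `|c|%N *: 'X^(j.+1)).
  rewrite rmorph_prod; apply: eq_bigr => j _.
  rewrite rmorphB rmorph1 -scalerAl -exprS /= map_polyZ map_polyXn /=.
  by rewrite at_neg1_zpow expN1r signr_odd.
have E1 : \prod_(j < k) (1 - (-1) ^+ true *: 'X^(j.+1)) =
    \prod_(j < k) (1 + 'X^(j.+1)) :> {poly int}.
  by apply: eq_bigr => j _; rewrite expr1 scaleN1r opprK.
have E2 : \prod_(j < k) (1 - (-1) ^+ false *: 'X^(j.+1)) =
    \prod_(j < k) (1 - 'X^(j.+1)) :> {poly int}.
  by apply: eq_bigr => j _; rewrite scale1r.
rewrite !big_cons big_nil !rmorphM rmorph1 /= !E.
rewrite ![odd _]/= E1 E2.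
ring.
Qed.

(** The numerator (q; q)_oo^2 cancels one part of the denominator, and Euler's
    identity inverts the other part (-q; q)_oo^2.  The inverse of the
    denominator is only known by its product with the denominator, so instead
    of simplifying a fraction the proof multiplies by
    (q; q^2)_oo^2 (-q; q)_oo^2, which is 1. *)
Lemma bicrank_gf_at_neg1 n :
  at_neg1 (bicrank_gf n) = (oddprod int n.+1 * oddprod int n.+1)`_n.
Proof.
pose A : {poly laurent} := \prod_(j < n.+1) (1 - 'X * 'X^j).
pose D := \prod_(a <- [:: zpow 1 *: 'X; zpow (-1) *: 'X;
                         zpow 2 *: 'X; zpow (-2) *: 'X])
  \prod_(j < n.+1) (1 - a * 'X^j).
pose V := \poly_(i < n.+1) series_inv bicrank_den i.
have V_approx : approx n V (series_inv bicrank_den).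
  by move=> i lein; rewrite coef_poly ltnS lein.
have gf_approx : approx n (A * A * V) bicrank_gf.
  by do !apply: approxM => //; apply: approx_qpoch.
have DV_approx : approx n (D * V) (series1 laurent).
  move=> i lein; rewrite (approxM (@approx_qpochs _ n _) V_approx) //.
  exact: bicrank_denV.
pose a : {poly int} := \prod_(j < n.+1) (1 - 'X^(j.+1)).
pose b : {poly int} := \prod_(j < n.+1) (1 + 'X^(j.+1)).
pose v := map_poly at_neg1 V; pose o := oddprod int n.+1.
have AE : map_poly at_neg1 A = a.
  rewrite rmorph_prod; apply: eq_bigr => j _.
  by rewrite rmorphB rmorph1 -exprS /= map_polyXn.
have bbaav_mod : eqmodX n (b ^+ 2 * a ^+ 2 * v) 1.
  move=> i lein; rewrite -bicrank_den_at_neg1 -rmorphM coef_map DV_approx //=.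
  by rewrite /series1 coef1 rmorph_nat.
have ob_mod : eqmodX n (o * b) 1 by apply: euler_eqmodX.
have oobb_mod : eqmodX n (o * b * (o * b)) 1.
  by rewrite -[1]mulr1; apply: eqmodXM.
rewrite -gf_approx // -coef_map rmorphM rmorphM /= AE -/v.
(* Both sides have the coefficient of the product o ^+ 2 * b ^+ 2 * a ^+ 2 * v,
   in which either o ^+ 2 * b ^+ 2 or b ^+ 2 * a ^+ 2 * v can be dropped. *)
transitivity ((a * a * v * (o * b * (o * b)))`_n).
  by rewrite (eqmodXM (p' := a * a * v) _ oobb_mod) ?mulr1.
have -> : a * a * v * (o * b * (o * b)) = o * o * (b ^+ 2 * a ^+ 2 * v) by ring.
by rewrite (eqmodXM (p' := o * o) _ bbaav_mod) ?mulr1.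
Qed.

Theorem theorem2p1 (n : nat) :
  (n = 0 %[mod 2] -> Mstar_mod 0 2 n > Mstar_mod 1 2 n) /\
  (n = 1 %[mod 2] -> Mstar_mod 0 2 n < Mstar_mod 1 2 n).
Proof.
have := @oddprod_sqr_gt0 int n n.+1.
rewrite -bicrank_gf_at_neg1 -Mstar_mod2B -signr_odd !modn2.
rewrite -addnn ltn_addr // => /(_ isT).
case: (odd n) => /= D_gt0; split=> // _.
  by rewrite -subr_lt0 -oppr_gt0 -mulN1r.
by rewrite -subr_gt0 -[X in 0 < X]mul1r.
Qed.
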